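(* Let $n\ge2$ and $0\le k\le n-1$. The following sets are equinumerous: (1) the set of ASM-recurrent configurations $c$ on $F_n$ with $\mathrm{level}(c)=k$; (2) the set of subgraphs $(V,E)$ of $P_n$ with $n\in V$ and $|E|=k$; (3) the set of Kimberling paths ending at $(n-k,k)$. In particular, if $T_{F_n}$ is the Tutte polynomial of $F_n$, then $$T_{F_n}(1,x)=\sum_{k=0}^{n-1}\big|\mathrm{Kimb}(n-k,k)\big|\,x^k,\qquad\text{where }\big|\mathrm{Kimb}(n-k,k)\big|=\sum_{r=0}^{n-k-1}\binom{n-k-1}{r}\binom{r+k}{r}.$$
   Context: $P_n$: path on $[n]$ with edges $\{i,i+1\}$; $F_n$: $P_n$ plus sink $0$ adjacent to all of $[n]$. A subgraph of $P_n$ is $(V,E)$ with $V\subseteq[n]$ non-empty and $E$ a set of edges of $P_n$ with both endpoints in $V$. Sandpile setting: configurations $c\in\mathbb{Z}_{\ge0}^n$, stable iff $c_i<\deg(i)$ (on $F_n$: $\{0,1,2\}^n$ with $c_1,c_n\le1$); ASM: unstable vertex loses $\deg(i)$ grains, one to each neighbour (grains to sink vanish); Markov chain adds a grain at a random vertex (fully supported distribution) and stabilises; ASM-recurrent = recurrent state. $\mathrm{level}(c)=\sum_ic_i+\deg(0)-|E(F_n)|=\sum_i c_i-(n-1)$. A Kimberling path is a lattice path from $(0,0)$ with steps $(a,b)$, $a\ge1$, $b\ge0$ integers (any length); $\mathrm{Kimb}(i,j)$ is the set of such paths ending at $(i,j)$. $T_G(x,y)$ is the standard Tutte polynomial. 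*)

(* Defs.v *)
From HB Require Import structures.
From mathcomp Require Import all_boot all_order all_algebra.
From mathcomp Require Import boolp.
From Stdlib Require Import Relation_Operators.
Set Implicit Arguments. Unset Strict Implicit. Unset Printing Implicit Defensive.
Import GRing.Theory.

(* ---------- The graph F_n ----------
   Vertices are 'I_n.+1 : vertex 0 is the sink, vertex i (1 <= i <= n) is the
   path vertex i. *)
Definition Fn_adj (n : nat) (x y : 'I_n.+1) : bool :=
  (x != y) &&
  [|| (val x == 0), (val y == 0), ((val x).+1 == val y) | ((val y).+1 == val x)].

Definition Fn_edges (n : nat) : {set {set 'I_n.+1}} :=
  [set e | [exists x : 'I_n.+1, exists y : 'I_n.+1, Fn_adj x y && (e == [set x; y])]].

Definition Pn_adj (n : nat) (x y : 'I_n.+1) : bool :=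
  (0 < val x) && (0 < val y) && (((val x).+1 == val y) || ((val y).+1 == val x)).

Definition Pn_edges (n : nat) : {set {set 'I_n.+1}} :=
  [set e | [exists x : 'I_n.+1, exists y : 'I_n.+1, Pn_adj x y && (e == [set x; y])]].

Definition Pn_subgraphs_k (n k : nat) : {set {set 'I_n.+1} * {set {set 'I_n.+1}}} :=
  [set VE : {set 'I_n.+1} * {set {set 'I_n.+1}} | [&& ord0 \notin VE.1, VE.1 != set0, VE.2 \subset Pn_edges n,
             [forall e in VE.2, e \subset VE.1],
             ord_max \in VE.1 & #|VE.2| == k]].

Section Tutte.
Variable T : finType.
Definition edge_rel (A : {set {set T}}) : rel T := fun x y => [set x; y] \in A.
Definition ncomp (A : {set {set T}}) : nat := #|roots (edge_rel A)|.
Definition grank (A : {set {set T}}) : nat := #|T| - ncomp A.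
Definition tutte_eval (R : comNzRingType) (E : {set {set T}}) (x y : R) : R :=
  \sum_(A in powerset E) (x - 1) ^+ (grank E - grank A) * (y - 1) ^+ (#|A| - grank A).
End Tutte.

(* ---------- Sandpile model on F_n ----------
   A configuration is c : {ffun 'I_n -> nat}; index i : 'I_n is the vertex
   i+1 of F_n, i.e. lift ord0 i. *)
Definition sv (n : nat) (i : 'I_n) : 'I_n.+1 := lift ord0 i.

Definition deg (n : nat) (i : 'I_n) : nat := #|[set v | Fn_adj (sv i) v]|.

Definition stable (n : nat) (c : {ffun 'I_n -> nat}) : bool :=
  [forall i, c i < deg i].

Definition topple (n : nat) (c : {ffun 'I_n -> nat}) (i : 'I_n) : {ffun 'I_n -> nat} :=
  [ffun j => if j == i then c j - deg i else c j + Fn_adj (sv i) (sv j)].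

Definition topple_step (n : nat) (c d : {ffun 'I_n -> nat}) : Prop :=
  exists i, deg i <= c i /\ d = topple c i.

Definition stabilizes (n : nat) (c d : {ffun 'I_n -> nat}) : Prop :=
  clos_refl_trans _ (@topple_step n) c d /\ stable d.

Definition add_grain (n : nat) (c : {ffun 'I_n -> nat}) (i : 'I_n) : {ffun 'I_n -> nat} :=
  [ffun j => c j + (j == i)].

(* one step of the Markov chain (positive probability transition) *)
Definition chain_step (n : nat) (c d : {ffun 'I_n -> nat}) : Prop :=
  exists i, stabilizes (add_grain c i) d.

Definition reach (n : nat) := clos_refl_trans _ (@chain_step n).

Definition recurrent (n : nat) (c : {ffun 'I_n -> nat}) : Prop :=
  stable c /\ forall d, reach c d -> reach d c.

(* Recurrent configurations are stable, hence have values in {0,1,2}: we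
   enumerate them as {ffun 'I_n -> 'I_3}. *)
Definition cfg (n : nat) (d : {ffun 'I_n -> 'I_3}) : {ffun 'I_n -> nat} :=
  [ffun i => val (d i)].

(* level(c) = sum_i c_i - (n-1) = k *)
Definition recurrent_level (n k : nat) : {set {ffun 'I_n -> 'I_3}} :=
  [set d | `[< recurrent (cfg d) >] && (\sum_i cfg d i == k + (n - 1))].

Definition is_kimb (i j : nat) (p : seq (nat * nat)) : bool :=
  all (fun st => 0 < st.1) p && (\sum_(st <- p) st.1 == i) && (\sum_(st <- p) st.2 == j).

(* Every Kimberling path ending at (i,j) has at most i steps, each step (a,b)
   with a <= i, b <= j; so the paths are faithfully encoded (injectively) by
   this finite type. *)
Definition kimb_code (i j : nat) : finType :=
  {m : 'I_i.+1 & m.-tuple ('I_i.+1 * 'I_j.+1)}.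

Definition kimb_decode (i j : nat) (p : kimb_code i j) : seq (nat * nat) :=
  [seq (val st.1, val st.2) | st <- tagged p].

Definition Kimb (i j : nat) : {set kimb_code i j} :=
  [set p | is_kimb i j (kimb_decode p)].

(* Main.v *)
Require Import Defs.
From HB Require Import structures.
From mathcomp Require Import all_boot all_order all_algebra.
From mathcomp Require Import zify ring boolp.
From Stdlib Require Import Relation_Operators.
Set Implicit Arguments. Unset Strict Implicit. Unset Printing Implicit Defensive.
Import GRing.Theory.
Local Open Scope ring_scope.

(** Let y_0 = 0, u_0 = 1, y_(n+1) = (1 + X) y_n + u_n and u_(n+1) = y_n + u_n.
    Each family is encoded by words of length n read by an automaton with two
    live states, and in each case the transfer matrix is, up to a diagonal
    conjugation and a scalar, the matrix of this recursion; so every generating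
    polynomial is y_n up to a monomial factor.
    - A subgraph (V, E) is read along the path; the state is the membership of
      the last vertex in V.
    - T(1, X) sums (X - 1)^(|A| - n) over the connected spanning subgraphs A of
      F_n; the state tells whether the current block of path edges has already
      met a spoke.
    - A stable configuration is recurrent iff it has no forbidden subconfiguration
      (by the burning algorithm).  Replacing c_i by c_i + 3 - deg i, this says
      that any two letters 0 are separated by a letter 2.
    The coefficients of y_n are the binomial sums by Pascal's rule, and these
    count the pairs of a composition of n - k and a weak composition of k with
    the same number of parts, that is, the Kimberling paths. *)

(** * Weighted words read by a finite automaton *)

Section TransferMatrix.
Variables (L : finType) (x0 : L) (Q : finType) (q0 : Q) (delta : Q -> L -> Q).
Variables (R : comNzRingType) (w : L -> R).

Fixpoint run (b : nat -> L) (m : nat) : Q :=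
  if m is m'.+1 then delta (run b m') (b m') else q0.

Lemma eq_run b c m : (forall i, (i < m)%N -> b i = c i) -> run b m = run c m.
Proof.
elim: m => //= m IH h; rewrite (h m) // IH // => i im.
by apply: h; apply: ltnW.
Qed.

(** A word becomes a total function on [nat] with junk letter [x0] from index n on, so that [run]
    can recurse on prefixes. *)
Definition ext n (f : {ffun 'I_n -> L}) (m : nat) : L := oapp f x0 (insub m).

Lemma ext_ord n (f : {ffun 'I_n -> L}) (i : 'I_n) : ext f i = f i.
Proof. by rewrite /ext valK. Qed.

Definition word_sum n (q : Q) : R :=
  \sum_(f : {ffun 'I_n -> L} | run (ext f) n == q) \prod_i w (f i).

Lemma word_sum0 q : word_sum 0 q = (q0 == q)%:R.
Proof.
rewrite /word_sum /= big_mkcond /=.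
rewrite (eq_bigr (fun=> (q0 == q)%:R)) => [|f _]; last by case: eqP; rewrite ?big_ord0.
by rewrite sumr_const card_ffun card_ord expn0.
Qed.

(** Splitting off the last letter multiplies by the transfer matrix, whose entry (p, q) is the total
    weight of the letters leading from p to q. *)
Lemma word_sumS n q :
  word_sum n.+1 q =
    \sum_(p : Q) word_sum n p * \sum_(a | delta p a == q) w a.
Proof.
pose h (ga : {ffun 'I_n -> L} * L) : {ffun 'I_n.+1 -> L} :=
  [ffun i => oapp ga.1 ga.2 (unlift ord_max i)].
pose h' (f : {ffun 'I_n.+1 -> L}) : {ffun 'I_n -> L} * L :=
  ([ffun i => f (lift ord_max i)], f ord_max).
have hK : cancel h h'.
  case=> g a; congr pair; last by rewrite ffunE /= unlift_none.
  by apply/ffunP=> i; rewrite !ffunE /= liftK.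
have h'K : cancel h' h.
  move=> f; apply/ffunP=> i; rewrite ffunE.
  by case: unliftP => [j ->|->] //=; rewrite ffunE.
have extS ga i : (i < n)%N -> ext (h ga) i = ext ga.1 i.
  move=> lt_in; rewrite /ext (insubT (fun x => x < n.+1)%N (ltnW lt_in : i < n.+1)%N).
  rewrite insubT /= ffunE.
  have -> : Sub i (ltnW lt_in : (i < n.+1)%N) = lift ord_max (Ordinal lt_in).
    by apply: val_inj; rewrite /= /bump leqNgt lt_in.
  by rewrite liftK.
have extn ga : ext (h ga) n = ga.2.
  rewrite -[X in ext _ X]/(val (@ord_max n)) ext_ord ffunE.
  by rewrite unlift_none.
rewrite /word_sum (reindex_onto h h') => [|f _]; last exact: h'K.
have -> : \sum_(p : Q) (\sum_(f : {ffun 'I_n -> L} | run (ext f) n == p)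
    \prod_i w (f i)) * (\sum_(a | delta p a == q) w a) =
    \sum_(f : {ffun 'I_n -> L}) \sum_(a | delta (run (ext f) n) a == q)
      (\prod_i w (f i)) * w a.
  rewrite [RHS](partition_big (fun f => run (ext f) n) xpredT) //=.
  apply: eq_bigr => p _; rewrite big_distrl /=.
  by apply: eq_bigr => f /eqP ->; rewrite big_distrr.
rewrite (pair_big_dep xpredT (fun f a => delta (run (ext f) n) a == q)
   (fun f a => (\prod_i w (f i)) * w a)) /=.
apply: eq_big => [[g a]|[g a] _].
  rewrite hK eqxx andbT /= extn /=.
  by rewrite (@eq_run (ext (h (g, a))) (ext g)) // => i; apply: extS.
rewrite big_ord_recr /= ffunE unlift_none /=; congr (_ * _).
apply: eq_bigr => i _; rewrite ffunE.
have -> : widen_ord (leqnSn n) i = lift ord_max i.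
  by apply: val_inj; rewrite /= /bump leqNgt ltn_ord.
by rewrite liftK.
Qed.

End TransferMatrix.

(** * The common generating polynomial and its coefficients *)

Fixpoint level_poly2 (n : nat) : {poly int} * {poly int} :=
  if n is n'.+1 then
    let: (y, u) := level_poly2 n' in ((1 + 'X) * y + u, y + u)
  else (0, 1).

Definition level_poly n := (level_poly2 n).1.
Definition colevel_poly n := (level_poly2 n).2.

Lemma level_polyS n : level_poly n.+1 = (1 + 'X) * level_poly n + colevel_poly n.
Proof. by rewrite /level_poly /colevel_poly /=; case: level_poly2. Qed.

Lemma colevel_polyS n : colevel_poly n.+1 = level_poly n + colevel_poly n.
Proof. by rewrite /level_poly /colevel_poly /=; case: level_poly2. Qed.

Lemma big_option_bool (R : nmodType) (F : option bool -> R) :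
  \sum_p F p = F None + (F (Some true) + F (Some false)).
Proof.
rewrite (bigD1 None) // (bigD1 (Some true)) //= (bigD1 (Some false)) //=.
by rewrite big1 ?addr0 // => [[[]|]].
Qed.

(* The factor t absorbs the three normalisations: the transition matrix below is
   t D M D^-1 with D = diag(t, 1), where M is the matrix of the recursion of
   level_poly2. *)
Lemma word_sum_level_poly (L : finType) (x0 : L)
    (delta : option bool -> L -> option bool) (w : L -> {poly int})
    (t : {poly int}) n :
  (forall a, delta None a = None) ->
  let M p q := \sum_(a | delta (Some p) a == Some q) w a in
  M true true = t * (1 + 'X) -> M false true = t ^+ 2 ->
  M true false = 1 -> M false false = t ->
  word_sum x0 (Some false) delta w n (Some true) = t ^+ n.+1 * level_poly n.
Proof.
move=> dN M Mtt Mft Mtf Mff.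
suff [] : word_sum x0 (Some false) delta w n (Some true) = t ^+ n.+1 * level_poly n
  /\ word_sum x0 (Some false) delta w n (Some false) = t ^+ n * colevel_poly n by [].
elim: n => [|n [IHt IHf]]; first by rewrite !word_sum0 mulr0 mulr1.
rewrite !word_sumS !big_option_bool IHt IHf -/(M true true) -/(M false true).
rewrite -/(M true false) -/(M false false) Mtt Mft Mtf Mff.
have dead b : \sum_(a | delta None a == Some b) w a = 0.
  by rewrite big_pred0 // => a; rewrite dN.
rewrite !dead !mulr0 !add0r level_polyS colevel_polyS !exprS.
by split; ring.
Qed.

Lemma sum_binS m (f : nat -> nat) :
  (\sum_(r < m.+2) 'C(m.+1, r) * f r =
   \sum_(r < m.+1) 'C(m, r) * (f r + f r.+1))%N.
Proof.
rewrite big_ord_recl /= bin0 mul1n.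
under eq_bigr do rewrite /bump /= add1n binS mulnDl.
rewrite big_split /= addnA.
under [in RHS]eq_bigr do rewrite mulnDr.
rewrite [RHS]big_split /=; congr addn.
rewrite [RHS]big_ord_recl /= bin0 mul1n; congr addn.
by rewrite big_ord_recr /= bin_small // mul0n addn0.
Qed.

Definition level_count (n k : nat) : nat :=
  (\sum_(r < n - k) 'C(n - k - 1, r) * 'C(r + k, r))%N.

(** The factor ['C(r + k - 1, k)] counts weak compositions of k into r parts, against r + 1 parts in
    [level_count]; truncated subtraction gives the right value at r = 0. *)
Definition colevel_count (n k : nat) : nat :=
  (\sum_(r < n - k) 'C(n - k - 1, r) * 'C(r + k - 1, k))%N.

(** Pascal's rule in the first binomial factor, after which [sum_binS] supplies both terms. *)
Lemma colevel_countS n k : (0 < n)%N ->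
  colevel_count n.+1 k = (level_count n k + colevel_count n k)%N.
Proof.
move=> n0; rewrite /colevel_count /level_count.
case: (leqP n k) => [nk|kn].
  (* Only k = n leaves a term on the left, namely C(n - 1, n) = 0. *)
  have [-> ->] : (n - k = 0 /\ n.+1 - k = (k == n))%N by lia.
  rewrite !big_ord0; case: eqP => [->|_]; rewrite ?big_ord0 //.
  by rewrite big_ord1 /= bin0 add0n bin_small // ltn_subrL.
have [m nk] : exists m, (n - k = m.+1)%N by exists (n - k).-1; lia.
have -> : (n.+1 - k = m.+2)%N by lia.
rewrite nk.
rewrite !subn1 /= (sum_binS m (fun r => 'C(r + k - 1, k))).
rewrite -big_split /=; apply: eq_bigr => r _.
rewrite -mulnDr; congr muln; rewrite addSn addnC; congr addn.
by rewrite subn1 /= -[RHS]bin_sub ?leq_addr // addKn.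
Qed.

(** Pascal's rule in the second binomial factor; the first factor and the range depend only on the
    difference of the two arguments. *)
Lemma level_countS n k : (0 < n)%N ->
  level_count n.+1 k =
    (colevel_count n.+1 k + (if k is k'.+1 then level_count n k' else 0))%N.
Proof.
move=> n0; rewrite /colevel_count /level_count.
case: k => [|k].
  by rewrite addn0 !subn0; apply: eq_bigr => r _; rewrite !addn0 bin0 binn.
rewrite subSS -big_split /=; apply: eq_bigr => r _.
rewrite -mulnDr addnS subn1 /=; congr muln.
have -> : ('C((r + k).+1, r) = 'C((r + k).+1, k.+1))%N.
  by rewrite -[RHS]bin_sub ?ltnS ?leq_addl //; congr binomial; lia.
rewrite binS addnC subn1 /= [in RHS]addnC; congr addn.
by rewrite -[RHS]bin_sub ?leq_addr //; congr binomial; lia.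
Qed.

Lemma coef_level_poly n k : (level_poly n.+1)`_k = (level_count n.+1 k)%:Z.
Proof.
suff [] : (level_poly n.+1)`_k = (level_count n.+1 k)%:Z /\
  (colevel_poly n.+1)`_k = (colevel_count n.+1 k)%:Z by [].
elim: n k => [|n IH] k.
  rewrite /level_count /colevel_count /level_poly /colevel_poly /=.
  rewrite mulr0 !add0r coef1 subn1; case: k => [|k] /=.
    by rewrite !big_ord1.
  by rewrite subSS sub0n !big_ord0.
have [Ey Eu] := IH k.
have E : (colevel_poly n.+2)`_k = (colevel_count n.+2 k)%:Z.
  by rewrite colevel_polyS coefD Ey Eu (colevel_countS k (ltn0Sn n)) PoszD.
(* Regrouping the recursion as y' = X y + u' gives the shape of [level_countS]. *)
split=> //; rewrite level_countS // level_polyS mulrDl mul1r -addrA addrCA addrC.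
rewrite -colevel_polyS coefD E mulrC coefMX ?PoszD; case: k {Ey Eu E} => [|k] //=.
by rewrite (proj1 (IH _)).
Qed.

Lemma level_poly_sum n : level_poly n.+1 = \sum_(k < n.+1) (level_count n.+1 k)%:R *: 'X^k.
Proof.
rewrite -[RHS](poly_def n.+1 (fun k => (level_count n.+1 k)%:R)).
apply/polyP=> k; rewrite coef_poly coef_level_poly pmulrn intz.
case: ltnP => // nk; rewrite /level_count.
have ->: (n.+1 - k = 0)%N by apply/eqP; rewrite subn_eq0.
by rewrite big_ord0.
Qed.

(** * Counting Kimberling paths by number of steps *)

Lemma card_tagged (I : finType) (J : I -> finType) (S : {set {i : I & J i}}) :
  #|S| = (\sum_i #|[set x : J i | Tagged J x \in S]|)%N.
Proof.
rewrite -sum1_card; under [RHS]eq_bigr do rewrite -sum1_card.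
rewrite (sig_big_dep xpredT (fun i x => x \in [set x | Tagged J x \in S]) (fun _ _ => 1%N)) /=.
by apply: eq_bigl => -[i x]; rewrite inE.
Qed.

(** Subtracting 1 from each of the r + 1 parts leaves a weak composition of i - r - 1. *)
Lemma card_positive_compositions i r : (r < i)%N ->
  #|[set t : r.+1.-tuple 'I_i.+1 | all (fun x : 'I_i.+1 => 0 < x)%N t &&
       (\sum_(x <- t) x == i)%N]| = 'C(i.-1, r).
Proof.
move=> ri.
have -> : 'C(i.-1, r) = 'C(r + (i - r.+1), r) by congr binomial; lia.
rewrite -card_ord_partitions.
have lt_sucr (x : 'I_(i - r.+1).+1) : (x.+1 < i.+1)%N by case: x => x /=; lia.
pose g (x : 'I_(i - r.+1).+1) : 'I_i.+1 := Ordinal (lt_sucr x).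
have g_inj : injective g by move=> x y [] /val_inj.
rewrite -(card_imset _ (f := map_tuple g)); last first.
  by move=> s t /(congr1 val) /= /(inj_map g_inj) /val_inj.
apply: eq_card => t; rewrite inE; apply/andP/imsetP => [[pos /eqP sm]|[s + ->]].
  have sm1 : (\sum_(l < r.+1) ((tnth t l).-1 + 1) = i)%N.
    rewrite -[RHS]sm big_tuple; apply: eq_bigr => l _.
    by rewrite addn1 prednK // (allP pos) // mem_tnth.
  move: sm1; rewrite big_split /= sum1_card card_ord => sm1.
  (* Each decreased part is bounded by their sum, so the [inord] below does not fall back on its
     default. *)
  have small l : ((tnth t l).-1 < (i - r.+1).+1)%N.
    have : ((tnth t l).-1 <= \sum_(k < r.+1) (tnth t k).-1)%N.
      by rewrite (bigD1 l) //= leq_addr.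
    by move: sm1 => /(congr1 (subn^~ r.+1)); rewrite addnK ltnS => ->.
  exists [tuple inord (tnth t l).-1 | l < r.+1].
    rewrite inE big_tuple; apply/eqP.
    move: sm1 => /(congr1 (subn^~ r.+1)); rewrite addnK => e; apply: etrans e.
    apply: eq_bigr => l _.
    rewrite tnth_mktuple inordK //.
  apply: eq_from_tnth => l; rewrite tnth_map tnth_mktuple; apply: val_inj => /=.
  by rewrite inordK ?small // prednK // (allP pos) // mem_tnth.
rewrite inE big_tuple => /eqP sm; split.
  by apply/allP => x /mapP [y _ ->].
rewrite big_tuple; under eq_bigr do rewrite tnth_map /= -addn1.
by rewrite big_split /= sm sum1_card card_ord; lia.
Qed.

(** A path with r + 1 steps is a pair of a composition of i + 1 and a weak composition of j, each
    with r + 1 parts; the empty path ends at the origin and contributes nothing. *)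
Lemma card_Kimb i j :
  #|Kimb i.+1 j| = (\sum_(r < i.+1) 'C(i, r) * 'C(r + j, r))%N.
Proof.
rewrite card_tagged [LHS]big_ord_recl [X in (X + _)%N](_ : _ = 0%N) ?add0n; last first.
  by apply: eq_card0 => t; rewrite !inE tuple0 /is_kimb /kimb_decode /= !big_nil.
apply: eq_bigr => r _; rewrite -(card_positive_compositions (ltn_ord r)) -card_ord_partitions.
rewrite -cardsX.
set P := setX _ _.
pose h (st : r.+1.-tuple 'I_i.+2 * r.+1.-tuple 'I_j.+1) : r.+1.-tuple ('I_i.+2 * 'I_j.+1) :=
  [tuple (tnth st.1 l, tnth st.2 l) | l < r.+1].
have h_inj : injective h.
  case=> s1 s2 [t1 t2] /= e; congr pair; apply: eq_from_tnth => l;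
    have := congr1 (fun t => tnth t l) e; by rewrite !tnth_mktuple => -[].
rewrite -(card_imset _ h_inj).
apply: eq_card => t.
have [st ->] : exists st, t = h st.
  exists (map_tuple fst t, map_tuple snd t).
  by apply: eq_from_tnth => l; rewrite tnth_mktuple !tnth_map -surjective_pairing.
rewrite mem_imset // !inE /is_kimb /kimb_decode /= all_map !big_map.
rewrite !big_tuple; congr (_ && _ && _).
- apply/allP/allP => [pos x /tnthP [l ->]|pos x /mapP [l _ ->]].
    by have := pos _ (mem_tnth l (h st)); rewrite tnth_mktuple.
  by rewrite /= pos // mem_tnth.
Qed.

(** * Recurrence and Dhar's criterion *)

Section Sandpile.
Local Open Scope nat_scope.
Variable n : nat.
Implicit Types (c d s : {ffun 'I_n -> nat}) (i j v : 'I_n) (S B : {set 'I_n}).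

Definition adj i j : bool := Fn_adj (sv i) (sv j).

Lemma adjE i j : adj i j = ((i.+1 == j :> nat) || (j.+1 == i :> nat)).
Proof.
rewrite /adj /Fn_adj /= /bump /= !add1n !eqSS /= -(inj_eq val_inj) /=.
by rewrite /bump /= !add1n; lia.
Qed.

Lemma adjC i j : adj i j = adj j i.
Proof. by rewrite !adjE orbC. Qed.

Lemma adjxx i : adj i i = false.
Proof. by rewrite adjE; lia. Qed.

Lemma degE i : deg i = (\sum_j adj i j).+1.
Proof.
rewrite /deg -sum1_card big_mkcond big_ord_recl /= inE.
rewrite {1}/Fn_adj /= add1n; congr S.
by apply: eq_bigr => j _; rewrite inE; case: ifP => h; rewrite /adj h.
Qed.

Definition deg_in S v : nat := \sum_(j in S) adj v j.

Lemma deg_in0 v : deg_in set0 v = 0.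
Proof. exact: big_set0. Qed.

(** The successor accounts for the edge to the sink. *)
Lemma deg_inC S v : deg v = (deg_in S v + deg_in (~: S) v).+1.
Proof.
rewrite degE (bigID (mem S)) /=; congr (_ + _).+1.
by apply: eq_bigl => j; rewrite inE.
Qed.

Lemma deg_inD1 S i v : i \in S -> deg_in S v = adj v i + deg_in (S :\ i) v.
Proof.
move=> iS; rewrite /deg_in (bigD1 i) //=; congr addn.
by apply: eq_bigl => j; rewrite !inE andbC.
Qed.

Definition add_config c s : {ffun 'I_n -> nat} := [ffun j => c j + s j].

Lemma topple_add_config c s i : deg i <= c i ->
  topple (add_config c s) i = add_config (topple c i) s.
Proof.
by move=> h; apply/ffunP => j; rewrite !ffunE; case: eqP => [->|_]; lia.
Qed.

Lemma toppleC c i j : i != j -> deg i <= c i -> deg j <= c j ->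
  topple (topple c i) j = topple (topple c j) i.
Proof.
move=> ij hi hj; apply/ffunP => k; rewrite !ffunE.
have [->|kj] := eqVneq k j; first by rewrite eq_sym (negPf ij); lia.
by have [->|ki] := eqVneq k i; lia.
Qed.

(** The closure of [topple_step] with its length recorded, as a measure for induction. *)
Fixpoint topplings (N : nat) c s : Prop :=
  if N is N'.+1 then exists2 i, deg i <= c i & topplings N' (topple c i) s
  else c = s.

Lemma topplings_cat N M c d s :
  topplings N c d -> topplings M d s -> topplings (N + M) c s.
Proof.
elim: N c => [|N IH] c /= => [-> //|[i hi h1] h2].
by exists i => //; apply: IH.
Qed.

Lemma clos_rt_topplings c s :
  clos_refl_trans _ (@topple_step n) c s <-> exists N, topplings N c s.
Proof.
split=> [|[N]].
  elim=> [x y [i [hi ->]]|x|x y z _ [N hN] _ [M hM]].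
  - by exists 1; exists i.
  - by exists 0.
  - by exists (N + M); apply: topplings_cat hM.
elim: N c => [|N IH] c /= => [->|[i hi /IH h]]; first exact: rt_refl.
by apply: rt_trans h; apply: rt_step; exists i.
Qed.

Lemma topplings_add_config N c d s :
  topplings N c d -> topplings N (add_config c s) (add_config d s).
Proof.
elim: N c => [|N IH] c /= => [-> //|[i hi /IH h]].
exists i; first by rewrite ffunE (leq_trans hi) ?leq_addr.
by rewrite topple_add_config.
Qed.

(* Topplings at distinct vertices commute, so the number of topplings needed to
   reach a stable configuration does not depend on their order. *)
Lemma topplings_exchange N c s i : stable s -> topplings N c s ->
  deg i <= c i -> exists2 N', N = N'.+1 & topplings N' (topple c i) s.
Proof.
move=> /forallP st; elim: N c => [|N IH] c /=.
  by move=> -> hi; have := st i; rewrite ltnNge hi.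
move=> [j hj h] hi; exists N => //.
have [-> //|ji] := eqVneq i j.
have [|N' -> h'] := IH _ h.
  by rewrite ffunE (negPf ji) (leq_trans hi) ?leq_addr.
exists j; first by rewrite ffunE eq_sym (negPf ji) (leq_trans hj) ?leq_addr.
by rewrite toppleC.
Qed.

(** The grains x are held back while c topples. Each such toppling is also legal with x present, so
    by exchange it shortens the remaining sequence; hence c stabilises. *)
Lemma stabilizes_below N c x s : stable s -> topplings N (add_config c x) s ->
  exists2 d, stabilizes c d & exists M, topplings M (add_config d x) s.
Proof.
move=> st; elim/ltn_ind: N c => N IH c h.
have [sc|] := boolP (stable c).
  by exists c; [split=> //; exact: rt_refl | exists N].
rewrite negb_forall => /existsP [i]; rewrite -leqNgt => hi.
have hi' : deg i <= add_config c x i by rewrite ffunE (leq_trans hi) ?leq_addr.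
have [N' eN h'] := topplings_exchange st h hi'.
rewrite topple_add_config // in h'; rewrite eN in IH.
have [d [h1 h2] h3] := IH _ (ltnSn N') _ h'; exists d => //; split=> //.
by apply: rt_trans h1; apply: rt_step; exists i.
Qed.

(** The grains of x may be added one at a time, stabilising after each, without changing the final
    result s. *)
Lemma reach_add_config s d x N : stable s -> stable d ->
  topplings N (add_config d x) s -> reach d s.
Proof.
move=> st; have [m] := ubnP (\sum_i x i).
elim: m => // m IH in d x N *; rewrite ltnS => le_m sd h.
have [x0|] := boolP [forall i, x i == 0].
  have ed : add_config d x = d.
    by apply/ffunP => i; rewrite ffunE (eqP (forallP x0 i)) addn0.
  move: h; rewrite ed; case: N => [->|N [i hi _]]; first exact: rt_refl.
  by have := forallP sd i; rewrite ltnNge hi.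
rewrite negb_forall => /existsP [i xi].
pose y : {ffun 'I_n -> nat} := [ffun j => x j - (j == i)].
have exy : add_config d x = add_config (add_grain d i) y.
  by apply/ffunP => j; rewrite !ffunE; case: eqP => [->|_] /=; lia.
rewrite exy in h; have [e de [M hM]] := stabilizes_below st h.
apply: (@rt_trans _ _ _ e); first by apply: rt_step; exists i.
apply: IH hM; last by case: de.
apply: leq_trans le_m; rewrite (bigD1 i) //= [X in _ < X](bigD1 i) //=.
rewrite ffunE eqxx -addSn leq_add //; first by lia.
by apply: leq_sum => j _; rewrite ffunE leq_subr.
Qed.

(** No set S supports a forbidden subconfiguration in the sense of Dhar. *)
Definition unforbidden c : Prop :=
  forall S, S != set0 -> exists2 v, v \in S & deg_in S v <= c v.

(* Dhar's burning algorithm: firing the sink once and then every vertex once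
   brings an unforbidden configuration back to itself. *)
Lemma burning c : unforbidden c ->
  exists N, topplings N (add_config c [ffun=> 1]) c.
Proof.
move=> uc.
(* The state after the sink and then the vertices of B have fired; the condition on B in [H] keeps
   the subtraction from truncating. *)
pose fired B : {ffun 'I_n -> nat} :=
  [ffun v => c v + 1 + deg_in B v - (if v \in B then deg v else 0)].
suff H m B : #|~: B| = m -> {in B, forall v, deg v <= c v + 1 + deg_in B v} ->
    topplings m (fired B) c.
  exists #|~: (set0 : {set 'I_n})|.
  have -> : add_config c [ffun=> 1] = fired set0.
    by apply/ffunP => v; rewrite !ffunE inE deg_in0; lia.
  by apply: H => // v; rewrite inE.
elim: m B => [|m IH] B cB legal.
  have cB0 : ~: B = set0 by apply/eqP; rewrite -cards_eq0 cB.
  apply/ffunP => v; rewrite ffunE.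
  have -> : v \in B by rewrite -[B]setCK cB0 setC0 inE.
  by rewrite (deg_inC B v) cB0 deg_in0 addn0 -addnA add1n addnK.
(* This v is ready to fire: it holds at least [deg_in (~: B) v] grains and has received one from the
   sink and one from each neighbour in B. *)
have [|v vB hv] := uc (~: B); first by rewrite -cards_eq0 cB.
have hdeg := deg_inC B v; rewrite inE in vB.
have add_deg u : deg_in (v |: B) u = adj v u + deg_in B u.
  by rewrite (deg_inD1 u (setU11 v B)) setU1K // adjC.
exists v; first by rewrite ffunE (negPf vB); lia.
have -> : topple (fired B) v = fired (v |: B).
  apply/ffunP => u; rewrite !ffunE !inE add_deg -/(adj v u).
  have [->|uv] /= := eqVneq u v; first by rewrite (negPf vB) adjxx; lia.
  by have [uB|uB] := boolP (u \in B); [have := legal _ uB; lia | lia].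
apply: IH.
  move: cB; rewrite [#|~: B|](cardsD1 v) inE vB => -[<-].
  by apply: eq_card => u; rewrite !inE negb_or.
move=> u; rewrite !inE add_deg => /orP [/eqP ->|/legal]; last by lia.
by rewrite adjxx; lia.
Qed.

(** Burning K times brings c + K back to c. With K the maximum of d, the configuration c + K
    dominates d, so it is reached by adding grains to d. *)
Lemma reach_unforbidden c d : stable c -> unforbidden c -> stable d -> reach d c.
Proof.
move=> sc uc sd; pose K := \max_i d i.
have [N hN] : exists N, topplings N (add_config c [ffun=> K]) c.
  have [M hM] := burning uc.
  elim: K => [|K [N hN]].
    by exists 0; apply/ffunP => i; rewrite !ffunE addn0.
  exists (M + N); apply: topplings_cat hN.
  have -> : add_config c [ffun=> K.+1] =
      add_config (add_config c [ffun=> 1]) [ffun=> K].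
    by apply/ffunP => i; rewrite !ffunE; lia.
  exact: topplings_add_config.
apply: (@reach_add_config _ _ [ffun i => c i + K - d i] N) => //.
suff -> : add_config d [ffun i => c i + K - d i] = add_config c [ffun=> K] by [].
apply/ffunP => i; rewrite !ffunE subnKC //.
by apply: leq_trans (leq_addl _ _); apply: (leq_bigmax i).
Qed.

(** If i lies in S, the witness for S minus i still works: its possible extra neighbour i in S is
    paid for by the grain received from i. *)
Lemma unforbidden_topple c i : unforbidden c -> unforbidden (topple c i).
Proof.
move=> uc S S0; have [iS|iS] := boolP (i \in S); last first.
  have [v vS hv] := uc S S0; exists v => //; rewrite ffunE.
  case: eqP => [e|_]; last by lia.
  by rewrite -e vS in iS.
have [Si0|Si0] := eqVneq (S :\ i) set0.
  by exists i => //; rewrite (deg_inD1 i iS) Si0 adjxx deg_in0.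
have [v] := uc _ Si0; rewrite !inE => /andP [vi vS] hv; exists v => //.
by rewrite ffunE (negPf vi) (deg_inD1 v iS) adjC -/(adj i v); lia.
Qed.

Lemma unforbidden_reach c d : unforbidden c -> reach c d -> unforbidden d.
Proof.
move=> + cd; elim: cd => [x y [i [/clos_rt_topplings [N]]]|//|x y z _ IH1 _ IH2 /IH1//].
move=> + _ ux; have: unforbidden (add_grain x i).
  move=> S /ux [v vS hv]; exists v => //.
  by rewrite ffunE (leq_trans hv) ?leq_addr.
elim: N (add_grain x i) => [|N IH] e ue /= => [<- //|[j hj]].
by apply: IH; apply: unforbidden_topple.
Qed.

Lemma stable_reach c d : stable c -> reach c d -> stable d.
Proof. by move=> + cd; elim: cd => [x y [i []]|//|x y z _ IH1 _ IH2 /IH1]. Qed.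

Lemma recurrentP c : recurrent c <-> stable c /\ unforbidden c.
Proof.
split=> [[sc rc]|[sc uc]]; last first.
  split=> // d cd; apply: reach_unforbidden => //.
  exact: stable_reach cd.
split=> //.
(* The maximal stable configuration is unforbidden and reachable from c, hence by recurrence reaches
   c, and the chain preserves [unforbidden]. *)
pose top : {ffun 'I_n -> nat} := [ffun i => (deg i).-1].
have stop : stable top by apply/forallP => i; rewrite ffunE degE.
apply: (@unforbidden_reach top).
  move=> S /set0Pn [v vS]; exists v => //.
  by rewrite ffunE (deg_inC S) leq_addr.
apply: rc; apply: (@reach_add_config _ _ [ffun i => top i - c i] 0) => //.
apply/ffunP => i; have := forallP sc i; rewrite !ffunE; lia.
Qed.

End Sandpile.

(** * From counting words to coefficients *)

Lemma card_words (L : finType) (x0 : L) (Q : finType) (q0 : Q)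
    (delta : Q -> L -> Q) (wt : L -> nat) n q m :
  #|[set f : {ffun 'I_n -> L} | (run q0 delta (ext x0 f) n == q) &&
      (\sum_i wt (f i) == m)%N]|%:Z =
  (word_sum x0 q0 delta (fun a => 'X^(wt a)) n q)`_m.
Proof.
rewrite coef_sum cardsE -sum1_card -natz natr_sum big_mkcondr /=.
apply: eq_bigr => f _; rewrite -(big_morph _ (exprD 'X) (expr0 'X)) coefXn eq_sym.
by case: eqP.
Qed.

(** * Degrees along the path *)

Section NeighbourCount.
Local Open Scope nat_scope.
Variable n : nat.
Implicit Types (v : 'I_n) (S : {set 'I_n}).

(** Membership for an index in [nat], false from n on, so that v - 1 and v + 1 need not be built as
    ordinals. *)
Definition hits S m : bool := [exists j in S, j == m :> nat].

Lemma sum_eq_hits S m : \sum_(j in S) (j == m :> nat) = hits S m.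
Proof.
case: (boolP (hits S m)) => [/exists_inP [j jS /eqP jm]|/exists_inPn no].
  rewrite (bigD1 j) //= jm eqxx big1 // => i /andP [_ ij].
  by apply/eqP; rewrite eqb0 -jm.
by rewrite big1 // => j /no /negPf ->.
Qed.

Lemma deg_in_hits S v : deg_in S v = (0 < v) && hits S v.-1 + hits S v.+1.
Proof.
rewrite /deg_in; under eq_bigr => j _.
  have -> : adj v j = (0 < v) && (j == v.-1 :> nat) + (j == v.+1 :> nat) :> nat.
    by rewrite adjE; lia.
  over.
rewrite big_split /= sum_eq_hits; congr addn.
case: (posnP v) => v0 /=; first by rewrite big1.
exact: sum_eq_hits.
Qed.

Lemma hits_interval i j m :
  hits [set v : 'I_n | (i <= v.+1) && (v <= j)] m = [&& m < n, i <= m.+1 & m <= j].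
Proof.
apply/exists_inP/and3P => [[v + /eqP <-]|[mn im mj]].
  by rewrite inE => /andP [].
by exists (Ordinal mn); rewrite ?inE ?im.
Qed.

Lemma hitsT m : hits [set: 'I_n] m = (m < n).
Proof.
apply/exists_inP/idP => [[v _ /eqP <-] //|mn].
by exists (Ordinal mn).
Qed.

Lemma sum_eq_ord m : \sum_(j < n) (j == m :> nat) = (m < n).
Proof.
by rewrite -hitsT -sum_eq_hits; apply: eq_bigl => j; rewrite inE.
Qed.

Lemma deg_nbrs v : deg v = ((0 < v) + (v.+1 < n)).+1.
Proof.
rewrite (deg_inC setT) setCT deg_in0 addn0 deg_in_hits !hitsT.
by have := ltn_ord v; lia.
Qed.

End NeighbourCount.

(* Between two letters 0 there must be a letter 2, where the word is thought of
   as preceded and followed by a letter 0: Some true (resp. Some false) says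
   that the last letter other than 1 is a 2 (resp. a 0). *)
Definition sandpile_step (q : option bool) (a : 'I_3) : option bool :=
  if q is Some p then
    if a == 0%N :> nat then (if p then Some false else None)
    else if a == 1%N :> nat then Some p else Some true
  else None.

(** * Recurrent configurations as words *)

Section RecurrentWords.
Local Open Scope nat_scope.
Implicit Type b : nat -> 'I_3.

Notation srun := (run (Some false) sandpile_step).

(** The index i starts the current run of letters 1, just after the last letter 0 or after the
    virtual one before the word. *)
Lemma srun_false b m : srun b m = Some false ->
  exists2 i, i <= m & (i = 0 \/ b i.-1 = 0 :> nat) /\
    forall k, i <= k < m -> b k = 1 :> nat.
Proof.
elim: m => [|m IH] /=; first by exists 0 => //; split; [left | case].
case E: (srun b m) => [p|] //=; case: ifP => [/eqP b0|b0].
  by case: p E => // _ _; exists m.+1 => //; split; [right | move=> k; lia].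
case: ifP => // /eqP b1 [ep]; rewrite ep in E.
have [i im [hi hk]] := IH E; exists i; first exact: leqW.
split=> // k /andP [ik]; rewrite ltnS leq_eqVlt => /orP [/eqP -> //|km].
by apply: hk; rewrite ik.
Qed.

Lemma srun_absorbing b m : srun b m = None ->
  exists i j, [/\ i <= j < m, i = 0 \/ b i.-1 = 0 :> nat,
    forall k, i <= k < j -> b k = 1 :> nat & b j = 0 :> nat].
Proof.
elim: m => [|m IH] //=; case E: (srun b m) => [p|] /=; last first.
  by move=> _; have [i [j [ij *]]] := IH E; exists i, j; split=> //; lia.
case: ifP => [/eqP b0|_]; last by case: ifP.
case: p E => // /srun_false [i im [hi hk]] _.
by exists i, m; split=> //; lia.
Qed.

Lemma run_absorbing (L Q : finType) (q0 q : Q) delta (b : nat -> L) m k :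
  (forall a, delta q a = q) -> m <= k -> run q0 delta b m = q -> run q0 delta b k = q.
Proof.
move=> dq; elim: k => [|k IH]; first by rewrite leqn0 => /eqP ->.
by rewrite leq_eqVlt => /orP [/eqP -> //|/IH h /h /= ->].
Qed.

Lemma sandpile_step0 q (a : 'I_3) : a = 0 :> nat ->
  sandpile_step q a = if q is Some true then Some false else None.
Proof. by rewrite /sandpile_step => ->; case: q => [[]|]. Qed.

Lemma sandpile_step1 q (a : 'I_3) : a = 1 :> nat -> sandpile_step q a = q.
Proof. by rewrite /sandpile_step => ->; case: q => [[]|]. Qed.

Local Arguments sandpile_step : simpl never.

Variable n : nat.
Hypothesis n1 : 1 < n.

Lemma unforbidden_srun (c : {ffun 'I_n -> nat}) b :
  (forall i : 'I_n, b i = c i + (3 - deg i) :> nat) ->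
  unforbidden c <-> srun b n = Some true.
Proof.
move=> hb.
have hb' (i : 'I_n) : b i = c i + (i == 0 :> nat) + (i.+1 == n) :> nat.
  by rewrite hb deg_nbrs; have := ltn_ord i; lia.
split=> [uc|acc].
  suff no_pattern i j : i <= j <= n -> i = 0 \/ b i.-1 = 0 :> nat ->
      (forall k, i <= k < j -> b k = 1 :> nat) -> j = n \/ b j = 0 :> nat -> False.
    case E: (srun b n) => [[]|] //.
      have [i im [hi hk]] := srun_false E.
      by case: (no_pattern i n) => //; [rewrite im leqnn | left].
    have [i [j [ij hi hk hj]]] := srun_absorbing E.
    by case: (no_pattern i j) => //; [lia | right].
  (* This interval from i - 1 to j, clipped to the path, is forbidden: its ends hold no grain and
     have one neighbour in S, while inner vertices hold one grain and have two. *)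
  move=> ij hi hk hj; pose S := [set v : 'I_n | (i <= v.+1) && (v <= j)].
  have [|v] := uc S.
    apply/set0Pn; have nj : minn j n.-1 < n by lia.
    by exists (Ordinal nj); rewrite inE /=; lia.
  rewrite inE deg_in_hits !hits_interval => /andP [iv vj].
  have vn := ltn_ord v; have := hb' v.
  have [ev|iv'] := eqVneq v.+1 i.
    case: hi => [|hi]; first by lia.
    by move: hi; rewrite -ev /= => ->; lia.
  have [ev|jv] := eqVneq (v : nat) j.
    case: hj => [|hj]; first by lia.
    by move: hj; rewrite -ev /= => ->; lia.
  by rewrite hk; lia.
move=> S /set0Pn [v0 v0S].
apply/exists_inP; apply: contraT; rewrite negb_exists_in => /forall_inP no.
have {}no v : v \in S -> c v < (0 < v) && hits S v.-1 + hits S v.+1.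
  by move=> /no; rewrite -ltnNge deg_in_hits.
(* The leftmost vertex v of a forbidden S holds no grain and has its right neighbour in S. *)
case: (arg_minnP val v0S) => v vS vmin.
have hits_ord m : hits S m -> exists2 u : 'I_n, u \in S & u = m :> nat.
  by move=> /exists_inP [u uS /eqP]; exists u.
have hits_lt m : hits S m -> m < n by move=> /hits_ord [u _ <-].
(* From v on no letter 2 is met before the automaton dies: a vertex of S with letter 1 passes
   membership in S to its right neighbour, unless it is the last vertex. *)
have inv d : v + d < n -> srun b (v + d).+1 = None \/
    srun b (v + d).+1 = Some false /\ ((v + d).+1 < n -> hits S (v + d).+1).
  elim: d => [|d IH] vdn.
    rewrite addn0; have left0 : (0 < v) && hits S v.-1 = false.
      apply/andP => -[vpos /hits_ord [u /vmin /= uv eu]].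
      by move: uv; rewrite eu; lia.
    have := no v vS; rewrite left0 add0n => cv.
    have hv : hits S v.+1 by move: cv; case: hits.
    have vn := hits_lt _ hv; have bv := hb' v; rewrite hv in cv.
    have [ev|vpos] := posnP v.
      by right; split=> //; rewrite /= ev /= sandpile_step1 //; move: bv; rewrite ev; lia.
    by rewrite /= sandpile_step0; [case: srun => [[]|]; [right|left|left] | lia].
  rewrite addnS in vdn *; have [e|[e hu]] := IH (ltnW vdn); rewrite /= in e *; rewrite e.
    by left.
  have [u uS eu] := hits_ord _ (hu vdn).
  have := no u uS; have := hb' u; rewrite eu /= => bu cu.
  have lt2 := @hits_lt (v + d).+2.
  have : b (v + d).+1 < 2.
    rewrite bu; case: (hits S (v + d).+2) lt2 cu => [/(_ isT)|_];
      case: (hits S (v + d)) => /=; lia.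
  case eb: (nat_of_ord (b (v + d).+1)) => [|[|]] // _.
    by left; rewrite sandpile_step0.
  right; rewrite sandpile_step1 //; split=> // lt_n.
  move: cu bu; rewrite eb; case: (hits S (v + d).+2) => //.
  by case: (hits S (v + d)) => /=; lia.
have vn := ltn_ord v; have := inv (n.-1 - v).
have -> : v + (n.-1 - v) = n.-1 by lia.
by rewrite prednK ?acc; [case; [lia| |case] | lia].
Qed.

(** One grain is added at each end of the path, where the degree is 2, so that all letters have the
    same threshold. *)
Definition bump_cfg (d : {ffun 'I_n -> 'I_3}) : {ffun 'I_n -> 'I_3} :=
  [ffun i => inord (d i + (3 - deg i))].
Definition unbump_cfg (f : {ffun 'I_n -> 'I_3}) : {ffun 'I_n -> 'I_3} :=
  [ffun i => inord (f i - (3 - deg i))].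

Definition accepted (f : {ffun 'I_n -> 'I_3}) : bool :=
  srun (ext ord0 f) n == Some true.

Lemma bump_cfgE d i : stable (cfg d) -> bump_cfg d i = d i + (3 - deg i) :> nat.
Proof.
move=> /forallP /(_ i); rewrite !ffunE => h; rewrite inordK //.
by rewrite deg_nbrs in h *; case: (0 < i) h; case: (i.+1 < n) => /=; lia.
Qed.

Lemma unbump_cfgE f i : unbump_cfg f i = f i - (3 - deg i) :> nat.
Proof. by rewrite ffunE inordK // (leq_ltn_trans (leq_subr _ _)). Qed.

(** The virtual zeros around the word forbid a letter 0 at either end, so [unbump_cfg] does not
    truncate. *)
Lemma accepted_ge f i : accepted f -> 3 - deg i <= f i.
Proof.
move=> /eqP acc; rewrite deg_nbrs.
have [f0|f0] := posnP (f i); last by have := ltn_ord i; lia.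
have [i0|i0] := posnP i.
  suff : srun (ext ord0 f) n = None by rewrite acc.
  apply: (@run_absorbing _ _ _ None _ _ 1) => //; first exact: ltnW.
  by rewrite /= sandpile_step0 //; have := ext_ord ord0 f i; rewrite i0 => ->.
have := ltn_ord i; rewrite leq_eqVlt => /orP [/eqP ei|]; last by lia.
have: srun (ext ord0 f) i.+1 = Some true by rewrite ei.
by rewrite /= sandpile_step0 ?ext_ord //; case: srun => [[]|].
Qed.

Lemma sum_bumps : \sum_(i < n) (3 - deg i) = 2.
Proof.
under eq_bigr => i _.
  have -> : 3 - deg i = (i == 0 :> nat) + (i == n.-1 :> nat).
    by rewrite deg_nbrs; have := ltn_ord i; lia.
  over.
by rewrite big_split /= !sum_eq_ord; lia.
Qed.

Lemma card_recurrent_level_words k :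
  #|recurrent_level n k| =
  #|[set f | accepted f && (\sum_i f i == k + n.+1)]|.
Proof.
have recP (d : {ffun 'I_n -> 'I_3}) : recurrent (cfg d) <->
    stable (cfg d) /\ accepted (bump_cfg d).
  rewrite recurrentP; split=> -[sd ud]; split=> //.
    by apply/eqP/(unforbidden_srun (c := cfg d)) => // i; rewrite ext_ord bump_cfgE // ffunE.
  apply/(unforbidden_srun (b := ext ord0 (bump_cfg d))); last exact/eqP.
  by move=> i; rewrite ext_ord bump_cfgE // ffunE.
have unbumpK f : accepted f -> bump_cfg (unbump_cfg f) = f.
  move=> acc; apply/ffunP => i; apply: val_inj; rewrite /= ffunE unbump_cfgE.
  by rewrite subnK ?inordK ?accepted_ge.
have bumpK d : stable (cfg d) -> unbump_cfg (bump_cfg d) = d.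
  move=> sd; apply/ffunP => i; apply: val_inj; rewrite /= unbump_cfgE bump_cfgE //.
  by rewrite addnK.
rewrite -(card_in_imset (f := unbump_cfg)); last first.
  move=> f g; rewrite !inE => /andP [/unbumpK ef _] /andP [/unbumpK eg _] e.
  by rewrite -ef -eg e.
have sum_bump d : stable (cfg d) ->
    \sum_i bump_cfg d i = \sum_i cfg d i + 2.
  move=> sd; rewrite -[X in _ + X]sum_bumps -big_split /=; apply: eq_bigr => i _.
  by rewrite bump_cfgE // ffunE.
apply: eq_card => d; rewrite inE; apply/andP/imsetP => [[/asboolP /recP [sd acc] sm]|[f]].
  exists (bump_cfg d); rewrite ?bumpK // inE acc sum_bump // (eqP sm).
  by apply/eqP; lia.
rewrite inE => /andP [acc sm] ->.
have st : stable (cfg (unbump_cfg f)).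
  apply/forallP => i; rewrite ffunE /= unbump_cfgE deg_nbrs.
  have := accepted_ge i acc; rewrite deg_nbrs.
  by move: (ltn_ord (f i)); case: (0 < i); case: (_ < n) => /=; move: (nat_of_ord (f i)) => x; lia.
split; first by apply/asboolP/recP; rewrite unbumpK.
by have := sum_bump _ st; rewrite unbumpK // (eqP sm) => e; apply/eqP; lia.
Qed.

Lemma sum_ord3 (R : nmodType) (P : pred 'I_3) (F : 'I_3 -> R) :
  (\sum_(a | P a) F a = (if P (inord 0) then F (inord 0) else 0) +
   ((if P (inord 1) then F (inord 1) else 0) + (if P (inord 2) then F (inord 2) else 0)))%R.
Proof.
rewrite big_mkcond !big_ord_recl big_ord0 /= addr0.
have e m (a : 'I_3) : a = m :> nat -> a = inord m.
  by move=> <-; rewrite inord_val.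
by rewrite -!(e 0 ord0, e 1 (lift ord0 ord0), e 2 (lift ord0 (lift ord0 ord0))).
Qed.

Lemma card_recurrent_level k : #|recurrent_level n k|%:Z = ((level_poly n)`_k)%R.
Proof.
rewrite card_recurrent_level_words.
rewrite (card_words ord0 (Some false) sandpile_step (fun a => a : nat)).
(* The factor X^(n + 1) cancels the offset n + 1 between level and letter sum. *)
rewrite (@word_sum_level_poly _ _ _ _ 'X) //; first by rewrite coefXnM ltnNge leq_addl addnK.
all: rewrite sum_ord3 /= /sandpile_step ?inordK //=.
all: ring.
Qed.


End RecurrentWords.

(** * Spokes and path edges of the fan *)

Section FanEdges.
Local Open Scope nat_scope.
Variable n : nat.
Implicit Types i j : 'I_n.

(** The vertex preceding [sv i]; it is the sink when i = 0. *)
Definition pv i : 'I_n.+1 := widen_ord (leqnSn n) i.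
Definition spoke i : {set 'I_n.+1} := [set ord0; sv i].
(* The path edge below sv i; for i = 0 this is a junk value, equal to spoke i. *)
Definition path_edge i : {set 'I_n.+1} := [set pv i; sv i].

Lemma pvE i j : j.+1 = i -> pv i = sv j.
Proof. by move=> e; apply: val_inj; rewrite /= -e. Qed.

Lemma spoke_inj : injective spoke.
Proof.
move=> i j /setP /(_ (sv i)); rewrite !inE eqxx orbT => /esym.
by rewrite -!(inj_eq val_inj) /= => /eqP [] /val_inj.
Qed.

Lemma path_edge_inj : injective path_edge.
Proof.
move=> i j e; apply: val_inj => /=.
have : sv i \in path_edge j by rewrite -e !inE eqxx orbT.
have : pv i \in path_edge j by rewrite -e !inE eqxx.
rewrite !inE -!(inj_eq val_inj) /= /bump /= !add1n.
by move=> /orP [] /eqP e1 /orP [] /eqP e2 //; lia.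
Qed.

Lemma path_edge_neq_spoke i j : 0 < i -> path_edge i != spoke j.
Proof.
move=> i0; apply/eqP => e; have : ord0 \in path_edge i by rewrite e !inE eqxx.
by rewrite !inE -!(inj_eq val_inj) /= orbF => /eqP i00; rewrite -i00 in i0.
Qed.

Lemma Pn_edgesE : Pn_edges n = [set path_edge i | i : 'I_n & 0 < i].
Proof.
apply/setP => e; rewrite inE; apply/existsP/imsetP => [[x /existsP [y]]|[i]].
  case/andP => /andP [/andP [x0 y0] xy] /eqP ->.
  wlog {xy} /eqP xy : x y x0 y0 / x.+1 == y.
    by move=> W; case/orP: xy => /W; [exact | rewrite setUC; exact].
  have xn : x < n by have := ltn_ord y; lia.
  exists (Ordinal xn); rewrite ?inE //; congr setU; congr set1; exact: val_inj.
rewrite inE => i0 ->; exists (pv i); apply/existsP; exists (sv i).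
by rewrite eqxx andbT /Pn_adj /= i0 eqxx.
Qed.

Lemma Fn_edgesE :
  Fn_edges n = [set spoke i | i : 'I_n] :|: [set path_edge i | i : 'I_n & 0 < i].
Proof.
rewrite -Pn_edgesE; apply/setP => e; rewrite !inE.
apply/idP/orP => [/existsP [x /existsP [y]]|[/imsetP [i _ ->]|]].
- case/andP => /andP [xy /or4P adj] /eqP ->.
  have spokeP z : z != ord0 -> [set ord0; z] \in [set spoke i | i : 'I_n].
    by case: (unliftP ord0 z) => [i -> _|->]; [apply/imsetP; exists i | rewrite eqxx].
  have [x0|x0] := eqVneq x ord0.
    by left; rewrite x0 spokeP // eq_sym -x0.
  have [y0|y0] := eqVneq y ord0.
    by left; rewrite y0 setUC spokeP // -y0.
  right; apply/existsP; exists x; apply/existsP; exists y.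
  rewrite eqxx andbT /Pn_adj !lt0n; move: x0 y0.
  rewrite -!(inj_eq val_inj) => /= x0 y0; rewrite x0 y0 /=.
  by case: adj; rewrite ?(negPf x0) ?(negPf y0) // => ->; rewrite ?orbT.
- apply/existsP; exists ord0; apply/existsP; exists (sv i).
  by rewrite eqxx andbT /Fn_adj -(inj_eq val_inj).
- case/existsP => x /existsP [y /andP [/andP [/andP [x0 y0] xy] exy]].
  apply/existsP; exists x; apply/existsP; exists y; rewrite exy andbT /Fn_adj xy !orbT andbT.
  by apply/eqP => e'; move: xy; rewrite e'; lia.
Qed.

End FanEdges.

(** * Subgraphs of the path as words *)

Section SubgraphWords.
Local Open Scope nat_scope.

(* Letter i tells whether the vertex i is in V, and whether the edge {i-1,i} is
   in E; the state is the membership of the last vertex. *)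
Definition subgraph_step (q : option bool) (a : bool * bool) : option bool :=
  if q is Some p then if a.2 && ~~ (a.1 && p) then None else Some a.1 else None.

(** The value [false] at 0 excludes the junk path edge below the first vertex. *)
Definition prev_vertex (b : nat -> bool * bool) m : bool :=
  if m is m'.+1 then (b m').1 else false.

Lemma subgraph_runP b m p :
  reflect (p = prev_vertex b m /\
           forall i, i < m -> (b i).2 -> (b i).1 && prev_vertex b i)
          (run (Some false) subgraph_step b m == Some p).
Proof.
elim: m p => [|m IH] p /=; first by apply: (iffP eqP) => [[<-]|[-> _]].
have [ap|nap] := boolP ((b m).2 ==> (b m).1 && prev_vertex b m); last first.
  apply: (iffP eqP) => [|[_ /(_ m (ltnSn m)) /implyP]]; last by rewrite (negPf nap).
  case E: (run _ _ b m) => [q|] //=; have /IH [-> _] := introT eqP E.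
  by rewrite -negb_imply nap.
apply: (iffP eqP) => [|[-> h]].
  case E: (run _ _ b m) => [q|] //=; have /IH [-> h] := introT eqP E.
  rewrite -negb_imply ap /= => -[->]; split=> // i.
  rewrite ltnS leq_eqVlt => /orP [/eqP ->|/h //]; exact/implyP.
have /IH /eqP -> : prev_vertex b m = prev_vertex b m /\
  forall i, i < m -> (b i).2 -> (b i).1 && prev_vertex b i.
  by split=> // i im; apply: h; apply: ltnW.
by rewrite /= -negb_imply ap.
Qed.

Variable n : nat.
Hypothesis n0 : 0 < n.

Definition word_subgraph (f : {ffun 'I_n -> bool * bool}) :
    {set 'I_n.+1} * {set {set 'I_n.+1}} :=
  ([set sv i | i : 'I_n & (f i).1], [set path_edge i | i : 'I_n & (f i).2]).

Lemma sv_inj : injective (@sv n).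
Proof. exact: lift_inj. Qed.

Lemma word_subgraph_inj : injective word_subgraph.
Proof.
move=> f g [/setP ev /setP ee]; apply/ffunP => i.
have := ev (sv i); have := ee (path_edge i).
rewrite !mem_imset ?inE; [|exact: sv_inj..|exact: path_edge_inj|exact: path_edge_inj].
by case: (f i) (g i) => [? ?] [? ?] /= -> ->.
Qed.

Lemma card_Pn_subgraphs_words k :
  #|Pn_subgraphs_k n k| =
  #|[set f : {ffun 'I_n -> bool * bool} |
      (run (Some false) subgraph_step (ext (false, false) f) n == Some true) &&
      (\sum_i ((f i).2 : nat) == k)]|.
Proof.
rewrite -(card_imset _ word_subgraph_inj).
have nn : n.-1 < n by rewrite prednK.
have maxE : ord_max = sv (Ordinal nn) by apply: val_inj; rewrite /= /bump /= add1n prednK.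
have card_edges (f : {ffun 'I_n -> bool * bool}) :
    #|(word_subgraph f).2| = \sum_i ((f i).2 : nat).
  rewrite card_imset; last exact: path_edge_inj.
  by rewrite -sum1_card big_mkcond; apply: eq_bigr => i _; rewrite inE; case: (f i).2.
have prev_ord (f : {ffun 'I_n -> bool * bool}) (i j : 'I_n) : j.+1 = i ->
    prev_vertex (ext (false, false) f) i = (f j).1.
  by move=> <-; rewrite /= ext_ord.
have prev_n (f : {ffun 'I_n -> bool * bool}) :
    prev_vertex (ext (false, false) f) n = (f (Ordinal nn)).1.
  by rewrite -{2}(prednK n0) /= -[n.-1]/(nat_of_ord (Ordinal nn)) ext_ord.
have mem_sv (f : {ffun 'I_n -> bool * bool}) i :
    (sv i \in (word_subgraph f).1) = (f i).1.
  by rewrite mem_imset ?inE //; exact: sv_inj.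
apply: eq_card => -[V E]; rewrite inE /=; apply/idP/imsetP => [|[f]].
  case/and5P => V0 _ EP /forall_inP EV /andP [Vmax /eqP Ek].
  pose f : {ffun 'I_n -> bool * bool} :=
    [ffun i : 'I_n => (sv i \in V, path_edge i \in E)].
  have e0 i : path_edge i \in E -> 0 < i.
    move=> /(subsetP EP); rewrite Pn_edgesE => /imsetP [j].
    by rewrite inE => j0 /path_edge_inj ->.
  have fVE : (V, E) = word_subgraph f.
    congr pair; apply/setP => x.
      case: (unliftP ord0 x) => [i ->|->]; first by rewrite (mem_sv f i) ffunE.
      rewrite (negPf V0); apply/esym/imsetP => -[i _ /(congr1 val)] //.
    apply/idP/imsetP => [xE|[i + ->]]; last by rewrite inE ffunE.
    have := subsetP EP _ xE; rewrite Pn_edgesE => /imsetP [i _ ex].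
    by exists i => //; rewrite inE ffunE -ex.
  exists f => //; rewrite inE -card_edges -fVE Ek eqxx andbT.
  apply/subgraph_runP; rewrite prev_n ffunE -maxE Vmax; split=> // i im.
  rewrite -[i]/(nat_of_ord (Ordinal im)) ext_ord ffunE /= => iE.
  have /subsetP iV := EV _ iE; rewrite (iV (sv _)) ?inE ?eqxx ?orbT //=.
  have ipos := e0 _ iE; have jn : i.-1 < n by lia.
  rewrite (@prev_ord f (Ordinal im) (Ordinal jn)) /= ?prednK // ffunE /=.
  by rewrite -(@pvE _ (Ordinal im)) /= ?prednK // iV // ?inE ?eqxx.
rewrite inE => /andP [/subgraph_runP [/esym + acc] /eqP sm] eVE.
rewrite prev_n => fmax.
have {}acc (i : 'I_n) : (f i).2 -> exists2 j : 'I_n, j.+1 = i & (f i).1 && (f j).1.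
  move=> fi; have := acc i (ltn_ord i); rewrite ext_ord => /(_ fi).
  have [->|i0] := posnP i; first by rewrite andbF.
  have jn : i.-1 < n by have := ltn_ord i; lia.
  by rewrite (@prev_ord _ _ (Ordinal jn)) /= ?prednK //; exists (Ordinal jn); rewrite /= ?prednK.
have [-> ->] : V = (word_subgraph f).1 /\ E = (word_subgraph f).2.
  by rewrite -eVE.
have Vmax : ord_max \in (word_subgraph f).1 by rewrite maxE mem_sv.
rewrite card_edges sm eqxx Vmax; apply/and5P; split => //.
- by apply/imsetP => -[i _ /(congr1 val)].
- by apply/set0Pn; exists ord_max.
- rewrite Pn_edgesE; apply/subsetP => e /imsetP [i]; rewrite inE => /acc [j ij _] ->.
  by rewrite imset_f // inE -ij.
apply/forall_inP => e /imsetP [i]; rewrite inE => /acc [j ij /andP [fi fj]] ->.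
by rewrite /path_edge subUset !sub1set (pvE ij) !mem_sv fi fj.
Qed.

End SubgraphWords.

Lemma sum_bool_pairs (R : nmodType) (P : pred (bool * bool)) (F : bool * bool -> R) :
  \sum_(a | P a) F a =
    (if P (true, true) then F (true, true) else 0) +
    (if P (true, false) then F (true, false) else 0) +
    ((if P (false, true) then F (false, true) else 0) +
     (if P (false, false) then F (false, false) else 0)).
Proof.
rewrite big_mkcond (eq_bigr (fun a => if P (a.1, a.2) then F (a.1, a.2) else 0));
  last by case.
rewrite -(pair_bigA _ (fun x y => if P (x, y) then F (x, y) else 0)) /=.
by rewrite !big_bool.
Qed.

Lemma card_Pn_subgraphs n k : (0 < n)%N ->
  #|Pn_subgraphs_k n k|%:Z = (level_poly n)`_k.
Proof.
move=> n0; rewrite card_Pn_subgraphs_words //.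
rewrite (card_words (false, false) (Some false) subgraph_step (fun a => a.2 : nat)).
rewrite (@word_sum_level_poly _ _ _ _ 1) //; first by rewrite expr1n mul1r.
all: by rewrite sum_bool_pairs /=; ring.
Qed.

(** * Connected edge sets *)

Section Connectivity.
Local Open Scope nat_scope.
Variable T : finType.
Implicit Types (A : {set {set T}}) (x y z : T).

Lemma edge_rel_sym A : connect_sym (edge_rel A).
Proof. by apply: sym_connect_sym => x y; rewrite /edge_rel setUC. Qed.

Lemma root_in_roots A x : fingraph.root (edge_rel A) x \in roots (edge_rel A).
Proof. by rewrite inE roots_root //; apply: edge_rel_sym. Qed.

Lemma ncomp_gt0 A x : 0 < ncomp A.
Proof.
by apply/card_gt0P; exists (fingraph.root (edge_rel A) x); apply: root_in_roots.
Qed.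

Lemma ncomp1P A x : reflect (forall y, connect (edge_rel A) x y) (ncomp A == 1).
Proof.
have symA := edge_rel_sym A.
apply: (iffP eqP) => [n1 y|conn].
  have /card_le1_eqP h : #|roots (edge_rel A)| <= 1 by rewrite -/(ncomp A) n1.
  by rewrite -(root_connect symA); apply/eqP/h; exact: root_in_roots.
rewrite /ncomp -(card1 (fingraph.root (edge_rel A) x)); apply: eq_card => y.
have := conn y; rewrite -(root_connect symA) => /eqP ryx.
by rewrite [RHS]inE -topredE /= /roots /= -ryx eq_sym.
Qed.

End Connectivity.

(** * Connected spanning subgraphs of the fan as words *)

Section SpanningWords.
Local Open Scope nat_scope.

(* Letter i tells whether the spoke at i and the path edge {i-1,i} are present;
   the first vertex has no such path edge and its second bit is always set, which
   accounts for the exponent |A| + 1 below. The state tells whether the current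
   vertex is already known to be joined to the sink; None means that a block of
   path edges has ended without meeting a spoke. *)
Definition spanning_step (q : option bool) (a : bool * bool) : option bool :=
  if q is Some p then
    if a.2 then Some (p || a.1) else if p then Some a.1 else None
  else None.

Implicit Type b : nat -> bool * bool.

Notation crun := (run (Some false) spanning_step).

(** For accepted words this yields at least n edges, so that the exponent |A| - n is not
    truncated. *)
Lemma crun_weight b m p : crun b m = Some p ->
  m + p <= \sum_(i < m) ((b i).1 + (b i).2).
Proof.
elim: m p => [|m IH] p /=; first by case=> <-.
case E: (crun b m) => [q|] //=; have := IH _ E; rewrite big_ord_recr /=.
by case: (b m) q {E} => [[] []] [] //= h [<-]; lia.
Qed.

Lemma crun_false b m : (b 0).2 -> crun b m = Some false -> m = 0 \/
  exists2 i, i < m & (i = 0 \/ (b i).2 = false) /\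
    forall k, i <= k < m -> (b k).1 = false.
Proof.
move=> b0; elim: m => [|m IH] /=; first by left.
case E: (crun b m) => [q|] //=; right.
case eb2: (b m).2 => [|] in H *.
  case: q E H => //= E [eb1].
  have [m0|[i im [hi hk]]] := IH E.
    by exists 0 => //; split; [left | move=> k; rewrite m0 in eb1 *; case: k].
  exists i; [exact: ltnW | split=> // k /andP [ik]].
  by rewrite ltnS leq_eqVlt => /orP [/eqP -> //|km]; apply: hk; rewrite ik.
case: q E H => //= E [eb1]; exists m => //; split; first by right.
by move=> k; rewrite ltnS -eqn_leq => /eqP <-.
Qed.

Lemma crun_absorbing b m : (b 0).2 -> crun b m = None ->
  exists i j, [/\ i < j < m, i = 0 \/ (b i).2 = false,
    forall k, i <= k < j -> (b k).1 = false & (b j).2 = false].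
Proof.
move=> b0; elim: m => [|m IH] //=; case E: (crun b m) => [q|] /=; last first.
  by move=> _; have [i [j [ij *]]] := IH E; exists i, j; split=> //; lia.
case eb2: (b m).2 => //; case: q E => // E _.
have [m0|[i im [hi hk]]] := crun_false b0 E; first by rewrite -m0 eb2 in b0.
by exists i, m; split=> //; lia.
Qed.

Variable n : nat.
Hypothesis n0 : 0 < n.
Implicit Types (A : {set {set 'I_n.+1}}) (f : {ffun 'I_n -> bool * bool}).

Definition edges_word A : {ffun 'I_n -> bool * bool} :=
  [ffun i : 'I_n => (spoke i \in A, (i == 0 :> nat) || (path_edge i \in A))].

Definition word_edges f : {set {set 'I_n.+1}} :=
  [set spoke i | i : 'I_n & (f i).1] :|:
  [set path_edge i | i : 'I_n & (0 < i) && (f i).2].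

Notation letters f := (ext (false, false) f).

Lemma letters0 A : (letters (edges_word A) 0).2.
Proof. by rewrite -[0]/(nat_of_ord (Ordinal n0)) ext_ord ffunE. Qed.

Lemma connected_accepted A : A \subset Fn_edges n ->
  crun (letters (edges_word A)) n = Some true ->
  forall y, connect (edge_rel A) ord0 y.
Proof.
move=> AE acc; have symA := edge_rel_sym A.
(* Every vertex up to m is joined to the sink or, as long as the current block has met no spoke, to
   the vertex m. *)
suff inv m p : m <= n -> crun (letters (edges_word A)) m = Some p ->
    forall x : 'I_n.+1, x <= m -> connect (edge_rel A) ord0 x \/
      (p = false /\ connect (edge_rel A) (inord m) x).
  move=> y; have [//||//|[]//] := inv n true _ acc y.
  by rewrite -ltnS.
elim: m p => [|m IH] p mn.
  move=> _ x; rewrite leqn0 => /eqP x0; left.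
  by have -> : x = ord0 by apply: val_inj.
have pvm : pv (Ordinal mn) = inord m.
  by apply: val_inj; rewrite /= inordK // ltnW.
have svm : sv (Ordinal mn) = inord m.+1.
  by apply: val_inj; rewrite /= /bump /= add1n inordK.
rewrite /=; case E: (crun _ m) => [q|] //=.
have {}IH := IH _ (ltnW mn) E.
rewrite -[m]/(nat_of_ord (Ordinal mn)) ext_ord ffunE /=.
set s := spoke _ \in A; set e := _ || _ => step.
have spokeC : s -> connect (edge_rel A) ord0 (inord m.+1).
  by rewrite -svm => sA; apply: connect1.
have pathC : m <> 0 -> e -> connect (edge_rel A) (inord m) (inord m.+1).
  move=> /eqP m0; rewrite /e (negPf m0) /= => eA.
  by rewrite -svm -pvm; apply: connect1.
have q0 : m = 0 -> q = false.
  by move=> m0; move: E; rewrite m0 /= => -[].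
have zero (x : 'I_n.+1) : m = 0 -> x <= m -> connect (edge_rel A) ord0 x.
  by move=> -> ; rewrite leqn0 => /eqP x0; have -> : x = ord0 by exact: val_inj.
have imm : (inord m : 'I_n.+1) <= m by rewrite inordK // ltnW.
move=> x; rewrite leq_eqVlt => /orP [/eqP xm|].
  have -> : x = inord m.+1 by apply: val_inj; rewrite /= inordK.
  case: (boolP s) => [/spokeC|ns]; first by left.
  case: (boolP p) => [pt|/negPf pf]; last by right.
  have et : e && q by move: step pt; rewrite (negPf ns); case: (e); case: (q) => // -[<-].
  case/andP: et => et qt; left.
  have m0 : m <> 0 by move=> /q0; rewrite qt.
  have [c0|[]] := IH (inord m) imm; last by rewrite qt.
  exact: connect_trans c0 (pathC m0 et).
rewrite ltnS => xm; have [c0|[qf cx]] := IH x xm; first by left.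
have [m0|/eqP m0] := eqVneq m 0; first by left; apply: zero.
have et : e by move: step; rewrite qf; case: (e).
have cmx : connect (edge_rel A) (inord m.+1) x.
  by apply: connect_trans cx; rewrite symA; apply: pathC.
case: (boolP s) => [/spokeC c0|ns]; first by left; apply: connect_trans cmx.
by right; split=> //; move: step; rewrite et qf (negPf ns) => -[].
Qed.

Lemma accepted_connected A : A \subset Fn_edges n ->
  (forall y, connect (edge_rel A) ord0 y) ->
  crun (letters (edges_word A)) n = Some true.
Proof.
move=> /subsetP AE conn; have symA := edge_rel_sym A.
have letter i : letters (edges_word A) (nat_of_ord i) =
    (spoke i \in A, (i == 0 :> nat) || (path_edge i \in A)).
  by rewrite ext_ord ffunE.
suff no_block i j : i < j <= n -> i = 0 \/ (letters (edges_word A) i).2 = false ->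
    (forall k, i <= k < j -> (letters (edges_word A) k).1 = false) ->
    j = n \/ (letters (edges_word A) j).2 = false -> False.
  case E: (crun _ n) => [[]|] //.
    have [en|[i im [hi hk]]] := crun_false (letters0 A) E; first by have := n0; rewrite en.
    by case: (no_block i n) => //; [rewrite im leqnn | left].
  have [i [j [ij hi hk hj]]] := crun_absorbing (letters0 A) E.
  by case: (no_block i j) => //; [lia | right].
(* A rejected word has a block without spokes and without path edges leaving it. Its vertices D
   (index k is vertex k + 1) are closed under adjacency and miss the sink. *)
move=> ij hi hk hj; pose D := [set x : 'I_n.+1 | i < x <= j].
have nilow : i < n by lia.
have : closed (edge_rel A) (mem D).
  move=> x y; rewrite /edge_rel => xyA.
  have pairD (a b : 'I_n.+1) : [set x; y] = [set a; b] ->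
      (a \in D) = (b \in D) -> (x \in D) = (y \in D).
    move=> /setP exy ab; have := exy x; have := exy y.
    rewrite !inE !eqxx ?orbT /= => /esym /orP yab /esym /orP xab.
    by case: xab yab => /eqP -> [] /eqP ->; rewrite !inE in ab *.
  have := AE _ xyA; rewrite Fn_edgesE => /setUP [] /imsetP [k + exy].
    move=> _; apply: (pairD ord0 (sv k)) => //; rewrite !inE /= /bump /= add1n.
    apply/esym/negP => kD; have := hk k; rewrite letter /= -exy xyA.
    by move=> /(_ _) H; have : true = false by apply: H; lia.
  rewrite inE => k0; apply: (pairD (pv k) (sv k)) => //.
  rewrite !inE /= /bump /= add1n.
  have ki : k <> i :> nat.
    move=> ek; case: hi => [i0|]; first by move: k0; rewrite ek i0.
    by rewrite -ek letter /= -exy xyA orbT.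
  have kj : k <> j :> nat.
    move=> ek; case: hj => [jn|]; first by have := ltn_ord k; lia.
    by rewrite -ek letter /= -exy xyA orbT.
  lia.
move=> /closed_connect /(_ _ _ (conn (sv (Ordinal nilow)))).
by rewrite !inE /= /bump /= add1n; lia.
Qed.

Lemma edges_wordK A : A \subset Fn_edges n -> word_edges (edges_word A) = A.
Proof.
move=> /subsetP AE; apply/setP => e; apply/setUP/idP.
  case=> /imsetP [i + ->]; rewrite inE ffunE //= => /andP [i0].
  by rewrite eqn0Ngt i0.
move=> eA; have := AE _ eA; rewrite Fn_edgesE => /setUP [] /imsetP [i + ee].
  by move=> _; left; apply/imsetP; exists i => //; rewrite inE ffunE -ee.
rewrite inE => i0; right; apply/imsetP; exists i => //.
by rewrite inE i0 ffunE /= -ee eA orbT.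
Qed.

Lemma accepted_head f : crun (letters f) n = Some true -> (letters f 0).2.
Proof.
move=> acc; apply: contraT => /negPf h0.
suff : crun (letters f) n = None by rewrite acc.
by apply: (@run_absorbing _ _ _ None _ _ 1) => //; rewrite /= h0.
Qed.

Lemma mem_spoke_word f (i : 'I_n) : (spoke i \in word_edges f) = (f i).1.
Proof.
rewrite inE mem_imset ?inE; last exact: spoke_inj.
case: imsetP => [[j]|]; last by rewrite orbF.
by rewrite inE => /andP [j0 _] e; have := path_edge_neq_spoke i j0; rewrite e eqxx.
Qed.

Lemma mem_path_word f (i : 'I_n) : 0 < i -> (path_edge i \in word_edges f) = (f i).2.
Proof.
move=> i0; rewrite inE orbC mem_imset ?inE; last exact: path_edge_inj.
rewrite i0; case: imsetP => [[j _ e]|]; last by rewrite orbF.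
by have := path_edge_neq_spoke j i0; rewrite e eqxx.
Qed.

(** [word_edges] forgets the second bit of the first letter, but acceptance forces that bit to be
    set. *)
Lemma word_edgesK f : crun (letters f) n = Some true -> edges_word (word_edges f) = f.
Proof.
move=> /accepted_head h; apply/ffunP => i; rewrite ffunE mem_spoke_word.
have [i0|i0] := posnP i.
  rewrite /= [RHS]surjective_pairing; congr pair.
  by have := ext_ord (false, false) f i; rewrite i0 => <-.
by rewrite mem_path_word // -surjective_pairing.
Qed.

Lemma word_edges_sub f : word_edges f \subset Fn_edges n.
Proof.
rewrite Fn_edgesE setUSS //; apply/subsetP => e /imsetP [i + ->].
  by move=> _; apply/imsetP; exists i.
by rewrite inE => /andP [i0 _]; apply/imsetP; exists i; rewrite ?inE.
Qed.

Lemma card_word_edges f : crun (letters f) n = Some true ->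
  #|word_edges f|.+1 = \sum_i ((f i).1 + (f i).2).
Proof.
move=> /accepted_head h; rewrite cardsU.
have -> : [set spoke i | i : 'I_n & (f i).1] :&:
    [set path_edge i | i : 'I_n & (0 < i) && (f i).2] = set0.
  apply/setP => e; rewrite inE in_set0; apply/andP => -[/imsetP [i _ ->] /imsetP [j]].
  by rewrite inE => /andP [j0 _] /eqP; rewrite eq_sym (negPf (path_edge_neq_spoke i j0)).
rewrite cards0 subn0 card_imset ?card_imset; [|exact: path_edge_inj|exact: spoke_inj].
rewrite big_split /= -addnS; congr addn.
  by rewrite -sum1_card big_mkcond; apply: eq_bigr => i _; rewrite inE; case: (f i).1.
rewrite (bigD1 (Ordinal n0)) //=.
have -> : (f (Ordinal n0)).2 by rewrite -(ext_ord (false, false)).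
rewrite add1n; congr S; rewrite -sum1_card big_mkcond [RHS]big_mkcond.
apply: eq_bigr => i _; rewrite inE -(inj_eq val_inj) /= lt0n.
by case: eqP; case: (f i).2.
Qed.

Lemma connected_spanning_words :
  [set A in powerset (Fn_edges n) | ncomp A == 1] =
  [set word_edges f | f in [set f | crun (letters f) n == Some true]].
Proof.
apply/setP => A; rewrite !inE; apply/andP/imsetP => [[AE /(ncomp1P _ ord0) cA]|[f]].
  exists (edges_word A); last by rewrite edges_wordK.
  by rewrite inE accepted_connected.
rewrite inE => /eqP acc ->; split; first exact: word_edges_sub.
apply/(ncomp1P _ ord0); apply: connected_accepted; first exact: word_edges_sub.
by rewrite word_edgesK.
Qed.

Lemma ncomp_Fn_edges : ncomp (Fn_edges n) = 1.
Proof.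
apply/eqP/(ncomp1P _ ord0) => y; case: (unliftP ord0 y) => [i ->|-> //].
by apply: connect1; rewrite /edge_rel Fn_edgesE inE; apply/orP; left; apply/imsetP; exists i.
Qed.

End SpanningWords.

(** * The Tutte polynomial at x = 1 *)

Lemma tutte_Fn n : (0 < n)%N ->
  tutte_eval (Fn_edges n) (1 : {poly int}) 'X = level_poly n.
Proof.
move=> n0; rewrite /tutte_eval subrr.
have X1 : 'X - 1 != 0 :> {poly int} by rewrite -polyC1 polyXsubC_eq0.
(* Multiplying by (X - 1)^(n + 1) matches the transfer matrix lemma with t = X - 1. *)
apply: (mulfI (expf_neq0 n.+1 X1)).
have <- : word_sum (false, false) (Some false) spanning_step
    (fun a => ('X - 1) ^+ (a.1 + a.2)) n (Some true) = ('X - 1) ^+ n.+1 * level_poly n.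
  by apply: word_sum_level_poly => //; rewrite sum_bool_pairs /=; ring.
(* The power of 0 is 1 exactly when A has full rank n, that is, when A is connected and spanning. *)
have -> : \sum_(A in powerset (Fn_edges n))
      0 ^+ (grank (Fn_edges n) - grank A) * ('X - 1) ^+ (#|A| - grank A) =
    \sum_(A in [set A in powerset (Fn_edges n) | ncomp A == 1%N])
      ('X - 1) ^+ (#|A| - n) :> {poly int}.
  rewrite [RHS](eq_bigl (fun A => (A \in powerset (Fn_edges n)) && (ncomp A == 1%N)));
    last by move=> A; rewrite inE.
  rewrite [RHS]big_mkcondr /=; apply: eq_bigr => A _.
  have := ncomp_gt0 A ord0; have := max_card (mem (roots (edge_rel A))).
  rewrite /grank ncomp_Fn_edges // -/(ncomp A) card_ord subn1 /= => le_n gt0.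
  have [->|n1] := eqVneq (ncomp A) 1%N.
    by rewrite subn1 /= subnn expr0 mul1r.
  rewrite expr0n; case: eqP => [|_]; last by rewrite mul0r.
  by move: (ncomp A) gt0 le_n n1 => c; lia.
rewrite connected_spanning_words // big_imset /=; last first.
  move=> f g; rewrite !inE => /eqP /(word_edgesK n0) ef /eqP /(word_edgesK n0) eg e.
  by rewrite -ef -eg e.
rewrite big_distrr /word_sum /=; apply: eq_big => f; first by rewrite inE.
rewrite inE => /eqP acc; rewrite -exprD.
have := crun_weight acc; have := card_word_edges n0 acc.
have -> : (\sum_(i < n) ((ext (false, false) f i).1 + (ext (false, false) f i).2) =
    \sum_i ((f i).1 + (f i).2))%N by apply: eq_bigr => i _; rewrite ext_ord.
move=> e le_n; rewrite -(big_morph _ (exprD ('X - 1)) (expr0 ('X - 1))) -e.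
by congr (_ ^+ _); rewrite -e addn1 ltnS in le_n; rewrite addSn subnKC.
Qed.

Theorem mainTheorem19 (n : nat) (hn : (2 <= n)%N) :
  (forall k : nat, (k <= n - 1)%N ->
     #|recurrent_level n k| = #|Pn_subgraphs_k n k| /\
     #|Pn_subgraphs_k n k| = #|Kimb (n - k) k| /\
     #|Kimb (n - k) k| =
       (\sum_(r < n - k) 'C(n - k - 1, r) * 'C(r + k, r))%N) /\
  tutte_eval (Fn_edges n) (1 : {poly int}) 'X =
    \sum_(k < n) (#|Kimb (n - k) k|)%:R *: 'X^k.
Proof.
have n0 : (0 < n)%N by exact: ltnW.
have KimbE k : (k < n)%N -> #|Kimb (n - k) k| = level_count n k.
  move=> kn; rewrite /level_count; have : (0 < n - k)%N by rewrite subn_gt0.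
  by case: (n - k)%N => // i _; rewrite card_Kimb subn1.
have coefE k : (level_poly n)`_k = (level_count n k)%:Z.
  by rewrite -(prednK n0) coef_level_poly.
split=> [k kn|].
  have kn' : (k < n)%N by lia.
  rewrite KimbE //; split; last split=> //.
    by apply/eqP; rewrite -eqz_nat card_recurrent_level // card_Pn_subgraphs.
  by apply/eqP; rewrite -eqz_nat card_Pn_subgraphs // coefE.
rewrite tutte_Fn // -{1}(prednK n0) level_poly_sum prednK //.
by apply: eq_bigr => k _; rewrite KimbE.
Qed.
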